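(* Let $(A,\Phi)$ be a finite-dimensional cosovereign (or sovereign) Hopf algebra over a field of characteristic zero. If $\dim^l_\Phi(A)\neq 0$ or $\dim^r_\Phi(A)\neq 0$, then $S\circ S=1_A$ and $A$ is semisimple and cosemisimple.
   Context: $S$ denotes the antipode of $A$ and $k$ the base field. A cosovereign Hopf algebra is a pair $(A,\Phi)$ where $A$ is a Hopf algebra with bijective antipode and $\Phi:A\to k$ is a character (unital algebra morphism) such that $S^{-1}=\Phi*S*\Phi^{-1}$ ($*$ convolution, $\Phi^{-1}$ the convolution inverse). A sovereign Hopf algebra is a pair $(A,\Phi)$ where $A$ is a Hopf algebra with bijective antipode and $\Phi\in A$ is a group-like element such that $S^{-1}(a)=\Phi S(a)\Phi^{-1}$ for all $a\in A$. If $(A,\Phi)$ is cosovereign and $V$ is a finite-dimensional right $A$-comodule with basis $(v_i)$ and coaction $v_i\mapsto\sum_j v_j\otimes a_{ji}$, its left and right dimensions (in the associated sovereign monoidal category of finite-dimensional comodules) are $\dim^l_\Phi(V)=\sum_i\Phi(a_{ii})$ and $\dim^r_\Phi(V)=\sum_i\Phi(S(a_{ii}))$; here $A$ is regarded as a right $A$-comodule via its comultiplication. If $(A,\Phi)$ is sovereign and $V$ is a finite-dimensional left $A$-module, $\dim^l_\Phi(V)=\mathrm{Tr}(\Phi)$ and $\dim^r_\Phi(V)=\mathrm{Tr}(\Phi^{-1})$, where $\Phi$ and $\Phi^{-1}$ are considered as operators on $V$; here $A$ is regarded as a left $A$-module via left multiplication. *)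

(* Defs.v *)
From HB Require Import structures.
From mathcomp Require Import all_boot all_order all_algebra all_field.

Set Implicit Arguments.
Unset Strict Implicit.
Unset Printing Implicit Defensive.

Import GRing.Theory.
Local Open Scope ring_scope.

Reserved Notation "u ⊗ v" (at level 40, left associativity).

(* Tensor products of finite-dimensional spaces: an element of tensor U V is   *)
(* the matrix of its coordinates in the basis (e_i ⊗ f_j), where e and f are   *)
(* the library bases of U and V. Lemmas tliftE and tlift_unique below give the *)
(* universal property, so that nothing depends on these choices of bases.      *)
Definition tensor (k : fieldType) (U V : vectType k) : Type :=
  'M[k]_(\dim {:U}, \dim {:V}).

HB.instance Definition _ (k : fieldType) (U V : vectType k) :=
  Vector.on (tensor U V).

Notation "U ⊗ V" := (tensor U V) : type_scope.

Definition tens (k : fieldType) (U V : vectType k) (u : U) (v : V) :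
    (U ⊗ V)%type :=
  \matrix_(i, j) (coord (vbasis {:U}) i u * coord (vbasis {:V}) j v).

Notation "u ⊗ v" := (tens u v) : ring_scope.

(* The linear map u ⊗ v |-> beta u v; only meaningful when beta is bilinear. *)
Definition tlift (k : fieldType) (U V : vectType k) (W : lmodType k)
    (beta : U -> V -> W) (t : (U ⊗ V)%type) : W :=
  \sum_i \sum_j
    (t : 'M_(_, _)) i j *: beta (vbasis {:U})`_i (vbasis {:V})`_j.

Definition bilin (k : fieldType) (U V W : lmodType k) (beta : U -> V -> W) :=
  (forall v, linear (beta^~ v)) /\ (forall u, linear (beta u)).

Section TensorMaps.

Variable k : fieldType.

Lemma tens_bilin (U V : vectType k) : bilin (@tens k U V).
Proof.
split=> [v a u1 u2|u a v1 v2]; apply/matrixP=> i j; rewrite !mxE linearP /=.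
  by rewrite mulrDl mulrA.
by rewrite mulrDr mulrCA.
Qed.

Lemma tlift_linear (U V : vectType k) (W : lmodType k) (beta : U -> V -> W) :
  linear (tlift beta).
Proof.
move=> a s t; rewrite /tlift scaler_sumr -big_split; apply: eq_bigr => i _.
rewrite scaler_sumr -big_split; apply: eq_bigr => j _ /=.
by rewrite !mxE scalerDl scalerA.
Qed.

HB.instance Definition _ (U V : vectType k) (W : lmodType k)
    (beta : U -> V -> W) :=
  GRing.isLinear.Build k (U ⊗ V)%type W *:%R (tlift beta) (tlift_linear beta).

Lemma tliftE (U V : vectType k) (W : lmodType k) (beta : U -> V -> W) u v :
  bilin beta -> tlift beta (u ⊗ v) = beta u v.
Proof.
case=> betal betar.
pose bl v := GRing.isLinear.Build k U W *:%R _ (betal v).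
pose Bl v : {linear U -> W} := HB.pack (beta^~ v) (bl v).
pose br u := GRing.isLinear.Build k V W *:%R _ (betar u).
pose Br u : {linear V -> W} := HB.pack (beta u) (br u).
rewrite {2}(coord_vbasis (memvf u)) -[beta _ v]/(Bl v _) linear_sum.
apply: eq_bigr => i _; rewrite linearZ /= {2}(coord_vbasis (memvf v)).
rewrite -[beta _ (\sum_(_ < _) _)]/(Br _ _) linear_sum scaler_sumr.
by apply: eq_bigr => j _; rewrite mxE linearZ /= scalerA.
Qed.

Lemma tens_sum (U V : vectType k) (t : (U ⊗ V)%type) :
  t = tlift (fun u v => u ⊗ v) t.
Proof.
rewrite /tlift; apply/matrixP=> i j; rewrite summxE (bigD1 i) //= summxE.
rewrite (bigD1 j) //= !mxE !coord_free ?(basis_free (vbasisP _)) // !eqxx !mulr1.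
rewrite !big1 ?addr0 // => [i' ne|j' ne]; last first.
  by rewrite !mxE !coord_free ?(basis_free (vbasisP _)) // (negbTE ne) !mulr0.
rewrite summxE big1 // => j' _.
by rewrite !mxE !coord_free ?(basis_free (vbasisP _)) // (negbTE ne) mul0r mulr0.
Qed.

Lemma tlift_unique (U V : vectType k) (W : lmodType k)
    (f g : {linear (U ⊗ V)%type -> W}) :
  (forall u v, f (u ⊗ v) = g (u ⊗ v)) -> f =1 g.
Proof.
move=> fg t; rewrite (tens_sum t) /tlift !linear_sum; apply: eq_bigr => i _.
by rewrite !linear_sum; apply: eq_bigr => j _; rewrite !linearZ /= fg.
Qed.

Definition tmap (U V U' V' : vectType k) (f : U -> U') (g : V -> V') :
    (U ⊗ V)%type -> (U' ⊗ V')%type :=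
  tlift (fun u v => f u ⊗ g v).

Definition tassoc (U V W : vectType k) :
    ((U ⊗ V) ⊗ W)%type -> (U ⊗ (V ⊗ W))%type :=
  tlift (fun t w => tlift (fun u v => u ⊗ (v ⊗ w)) t).

Definition tunitl (V : vectType k) : (k^o ⊗ V)%type -> V :=
  tlift (fun (a : k^o) v => (a : k) *: v).

Definition tunitr (V : vectType k) : (V ⊗ k^o)%type -> V :=
  tlift (fun v (a : k^o) => (a : k) *: v).

Definition tmul (A B : falgType k) (s t : (A ⊗ B)%type) : (A ⊗ B)%type :=
  tlift (fun a b => tlift (fun c d => (a * c) ⊗ (b * d)) t) s.

Definition tensv (U V : vectType k) (U' : {vspace U}) (V' : {vspace V}) :
    {vspace (U ⊗ V)%type} :=
  <<[seq u ⊗ v | u <- vbasis U', v <- vbasis V']>>%VS.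

End TensorMaps.

HB.mixin Record Vector_isCoalgebra (k : fieldType) C of Vector k C := {
  comul : 'Hom(C, (C ⊗ C)%type);
  counit : 'Hom(C, k^o);
  comulA : forall c : C,
    tassoc (tmap comul idfun (comul c)) = tmap idfun comul (comul c);
  comul_counitl : forall c : C, tunitl (tmap counit idfun (comul c)) = c;
  comul_counitr : forall c : C, tunitr (tmap idfun counit (comul c)) = c
}.

#[short(type="coalgType")]
HB.structure Definition Coalgebra (k : fieldType) :=
  { C of Vector k C & Vector_isCoalgebra k C }.

Definition conv (k : fieldType) (C : coalgType k) (B : algType k)
    (f g : C -> B) : C -> B :=
  fun c => tlift (fun x y => f x * g y) (comul c).

HB.mixin Record Coalgebra_isHopf (k : fieldType) A
    of Falgebra k A & Coalgebra k A := {
  comulM : forall a b : A,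
    comul (a * b) = tmul (comul a) (comul b) :> (A ⊗ A)%type;
  comul1 : comul (1 : A) = 1 ⊗ 1;
  counitM : forall a b : A, counit (a * b) = counit a * counit b;
  counit1 : counit (1 : A) = 1;
  antipode : 'End(A);
  conv_antipodel : forall a : A,
    conv (antipode : A -> A) (idfun : A -> A) a = (counit a)%:A;
  conv_antipoder : forall a : A,
    conv (idfun : A -> A) (antipode : A -> A) a = (counit a)%:A
}.

#[short(type="hopfAlgType")]
HB.structure Definition HopfAlgebra (k : fieldType) :=
  { A of Falgebra k A & Coalgebra k A & Coalgebra_isHopf k A }.

Definition has_complement (k : fieldType) (V : vectType k)
    (stable : {vspace V} -> Prop) (W : {vspace V}) : Prop :=
  exists W' : {vspace V},
    [/\ stable W', (W + W' = fullv)%VS & (W :&: W' = 0)%VS].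

Section Modules.

Variables (k : fieldType) (A : falgType k).

Definition is_module (V : vectType k) (rho : A -> 'End(V)) : Prop :=
  [/\ linear rho, rho 1 = \1%VF & forall a b, rho (a * b) = (rho a \o rho b)%VF].

Definition submodule (V : vectType k) (rho : A -> 'End(V)) (W : {vspace V}) :=
  forall a, (rho a @: W <= W)%VS.

(* A is semisimple when all its finite-dimensional left modules, the regular   *)
(* one included, are semisimple, i.e. all their submodules have complements.   *)
Definition semisimple : Prop :=
  forall (V : vectType k) (rho : A -> 'End(V)), is_module rho ->
  forall W, submodule rho W -> has_complement (submodule rho) W.

Lemma regular_module : is_module (fun a : A => amull a).
Proof.
split=> [||a b]; first exact: linearP; first by rewrite amull1.
by rewrite amullM.
Qed.

End Modules.

Arguments semisimple {k} A.

Section Comodules.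

Variables (k : fieldType) (C : coalgType k).

Definition is_comodule (V : vectType k) (rho : 'Hom(V, (V ⊗ C)%type)) : Prop :=
  (forall v, tassoc (tmap rho idfun (rho v)) = tmap idfun comul (rho v)) /\
  (forall v, tunitr (tmap idfun counit (rho v)) = v).

Definition subcomodule (V : vectType k) (rho : 'Hom(V, (V ⊗ C)%type))
    (W : {vspace V}) : Prop :=
  (rho @: W <= tensv W {:C})%VS.

(* Every comodule is the sum of its finite-dimensional subcomodules, so it     *)
(* makes no difference that only finite-dimensional comodules are considered.  *)
Definition cosemisimple : Prop :=
  forall (V : vectType k) (rho : 'Hom(V, (V ⊗ C)%type)), is_comodule rho ->
  forall W, subcomodule rho W -> has_complement (subcomodule rho) W.

Lemma regular_comodule : is_comodule (comul : 'Hom(C, (C ⊗ C)%type)).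
Proof. by split; [exact: comulA | exact: comul_counitr]. Qed.

(* The a_ji such that rho v_i = \sum_j v_j ⊗ a_ji, where X = (v_i) is a basis. *)
Definition comod_coef (V : vectType k) (rho : 'Hom(V, (V ⊗ C)%type))
    n (X : n.-tuple V) (j i : 'I_n) : C :=
  tlift (fun v c => coord X j v *: c) (rho X`_i).

Lemma comod_coefE (V : vectType k) (rho : 'Hom(V, (V ⊗ C)%type))
    n (X : n.-tuple V) (i : 'I_n) :
  basis_of {:V} X -> rho X`_i = \sum_(j < n) X`_j ⊗ comod_coef rho X j i.
Proof.
move=> bX; have [tl tr] := tens_bilin V C; rewrite /comod_coef.
move: (rho _) => t.
have lf : linear (fun t : (V ⊗ C)%type =>
    \sum_(j < n) X`_j ⊗ tlift (fun v c => coord X j v *: c) t).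
  move=> a t1 t2; rewrite scaler_sumr -big_split; apply: eq_bigr => j _ /=.
  by rewrite linearP /= tr.
pose f : {linear (V ⊗ C)%type -> (V ⊗ C)%type} :=
  HB.pack (fun t : (V ⊗ C)%type =>
    \sum_(j < n) X`_j ⊗ tlift (fun v c => coord X j v *: c) t)
  (GRing.isLinear.Build k (V ⊗ C)%type (V ⊗ C)%type *:%R _ lf).
apply: (@tlift_unique k V C _ (idfun : {linear _ -> _}) f) => v c /=.
rewrite {1}(coord_basis bX (memvf v)).
pose Bl : {linear V -> (V ⊗ C)%type} :=
  HB.pack (fun v => v ⊗ c) (GRing.isLinear.Build k V (V ⊗ C)%type *:%R _ (tl c)).
rewrite -[_ ⊗ c]/(Bl _) linear_sum; apply: eq_bigr => j _.
rewrite linearZ /= tliftE; last first.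
  split=> [d a v1 v2|w a c1 c2]; first by rewrite linearP /= scalerDl scalerA.
  by rewrite scalerDr !scalerA mulrC.
pose Br : {linear C -> (V ⊗ C)%type} :=
  HB.pack (tens X`_j) (GRing.isLinear.Build k C (V ⊗ C)%type *:%R _ (tr X`_j)).
by rewrite -[RHS]/(Br _) linearZ.
Qed.

End Comodules.

Arguments cosemisimple {k} C.

Section Trace.

Variables (k : fieldType) (V : vectType k).

Definition lftrace (f : 'End(V)) : k :=
  \tr (passmx.mxof (vbasis {:V}) (vbasis {:V}) f).

Lemma sum_coord_indep (f : 'End(V)) n m (X : n.-tuple V) (Y : m.-tuple V) :
  basis_of {:V} X -> basis_of {:V} Y ->
  \sum_(i < n) coord X i (f X`_i) = \sum_(i < m) coord Y i (f Y`_i).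
Proof.
move=> bX bY.
transitivity (\sum_(i < n) \sum_(j < m) coord Y j X`_i * coord X i (f Y`_j)).
  apply: eq_bigr => i _; rewrite {1}(coord_basis bY (memvf X`_i)) !linear_sum /=.
  by apply: eq_bigr => j _; rewrite !linearZ.
rewrite exchange_big; apply: eq_bigr => j _ /=.
rewrite {2}(coord_basis bX (memvf (f Y`_j))) linear_sum /=.
by apply: eq_bigr => i _; rewrite linearZ /= mulrC.
Qed.

Lemma lftraceE (f : 'End(V)) n (X : n.-tuple V) :
  basis_of {:V} X -> lftrace f = \sum_(i < n) coord X i (f X`_i).
Proof.
move=> bX; rewrite (sum_coord_indep f bX (vbasisP {:V})).
apply: eq_bigr => i _.
by rewrite mxE /= mxE /= passmx.vecof_delta.
Qed.

End Trace.

Section HopfDims.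

Variables (k : fieldType) (A : hopfAlgType k).

Definition conv_inverse (C : coalgType k) (B : algType k) (f g : C -> B) :=
  forall c, conv f g c = (counit c)%:A /\ conv g f c = (counit c)%:A.

(* Convolution of Phi : A -> k with S : A -> A takes place in Hom(A, A), where *)
(* Phi is viewed through the unit map k -> A.                                  *)
Definition cosovereign (Phi : {lrmorphism A -> k^o}) : Prop :=
  bijective (antipode : A -> A) /\
  exists Psi : 'Hom(A, k^o),
    conv_inverse Phi Psi /\
    (forall a : A, (antipode^-1)%VF a =
       conv (conv (fun x => (Phi x)%:A) antipode) (fun x => (Psi x)%:A) a).

(* Independent of the chosen basis of V, by comod_dimlE and comod_dimrE below. *)
Definition comod_diml (Phi : {lrmorphism A -> k^o}) (V : vectType k)
    (rho : 'Hom(V, (V ⊗ A)%type)) : k :=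
  \sum_i Phi (comod_coef rho (vbasis {:V}) i i).

Definition comod_dimr (Phi : {lrmorphism A -> k^o}) (V : vectType k)
    (rho : 'Hom(V, (V ⊗ A)%type)) : k :=
  \sum_i Phi (antipode (comod_coef rho (vbasis {:V}) i i)).

Lemma sum_comod_coef_indep (V : vectType k) (rho : 'Hom(V, (V ⊗ A)%type))
    (phi : {linear A -> k^o}) n m (X : n.-tuple V) (Y : m.-tuple V) :
  basis_of {:V} X -> basis_of {:V} Y ->
  \sum_i phi (comod_coef rho X i i) = \sum_i phi (comod_coef rho Y i i).
Proof.
move=> bX bY; pose th := linfun (tlift (fun v c => (phi c : k) *: v) \o rho).
have E p (Z : p.-tuple V) i : phi (comod_coef rho Z i i) = coord Z i (th Z`_i).
  rewrite lfunE /= /comod_coef /tlift !linear_sum /=; apply: eq_bigr => a _.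
  rewrite !linear_sum; apply: eq_bigr => b _ /=.
  by rewrite !linearZ /=; congr (_ * _); apply: mulrC.
rewrite (eq_bigr _ (fun i _ => E n X i)) (eq_bigr _ (fun i _ => E m Y i)).
exact: (sum_coord_indep th bX bY).
Qed.

Lemma comod_dimlE Phi (V : vectType k) (rho : 'Hom(V, (V ⊗ A)%type))
    n (X : n.-tuple V) :
  basis_of {:V} X -> comod_diml Phi rho = \sum_i Phi (comod_coef rho X i i).
Proof. exact: (@sum_comod_coef_indep _ _ Phi _ _ _ _ (vbasisP _)). Qed.

Lemma comod_dimrE Phi (V : vectType k) (rho : 'Hom(V, (V ⊗ A)%type))
    n (X : n.-tuple V) :
  basis_of {:V} X ->
  comod_dimr Phi rho = \sum_i Phi (antipode (comod_coef rho X i i)).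
Proof.
exact: (@sum_comod_coef_indep _ _ (Phi \o antipode) _ _ _ _ (vbasisP _)).
Qed.

Definition grouplike (x : A) : Prop := comul x = x ⊗ x /\ counit x = 1.

Lemma grouplike_unit (x : A) : grouplike x ->
  x \is a GRing.unit /\ x^-1 = antipode x.
Proof.
case=> dx ex.
have Sx : antipode x * x = 1.
  have := conv_antipodel x; rewrite ex scale1r /conv dx tliftE //.
  split=> [v a u1 u2|u a v1 v2]; last by rewrite mulrDr scalerAr.
  by rewrite linearP mulrDl scalerAl.
have xS : x * antipode x = 1.
  have := conv_antipoder x; rewrite ex scale1r /conv dx tliftE //.
  split=> [v a u1 u2|u a v1 v2]; first by rewrite mulrDl scalerAl.
  by rewrite linearP mulrDr scalerAr.
have ux : x \is a GRing.unit by apply/unitrP; exists (antipode x).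
by split=> //; rewrite -[LHS]mulr1 -xS mulKr.
Qed.

(* A group-like Phi is a unit of A by grouplike_unit, so Phi^-1 is its inverse. *)
Definition sovereign (Phi : A) : Prop :=
  [/\ bijective (antipode : A -> A), grouplike Phi
    & forall a : A, (antipode^-1)%VF a = Phi * antipode a * Phi^-1].

Definition mod_diml (Phi : A) (V : vectType k) (rho : A -> 'End(V)) : k :=
  lftrace (rho Phi).

Definition mod_dimr (Phi : A) (V : vectType k) (rho : A -> 'End(V)) : k :=
  lftrace (rho Phi^-1).

End HopfDims.

(* Main.v *)
(* The regular representation is probed by traces. For a group-like Phi       *)
(* implementing S^-1, the trace t of left multiplication by Phi satisfies t 1 *)
(* = t Phi^-1: rewrite 1 ⊗ Phi b as S(b1) Phi^-1 (Phi b2)_1 ⊗ (Phi b2)_2 and  *)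
(* use cyclicity of the trace to move b2 |-> Phi b2 to the other end, where   *)
(* S(c2) Phi^-1 c1 collapses to Phi^-1. The same works for left               *)
(* multiplication by Phi^-1, whose trace is that of right multiplication by   *)
(* Phi, and dually for characters. So a nonzero dimension forces Phi to be    *)
(* trivial and S o S = 1. Then a |-> Tr(b |-> a b) and the element            *)
(* representing the dual trace are integrals whose values at the unit and     *)
(* under the counit are dim A <> 0, and averaging a projection over them      *)
(* (Maschke) yields complements.                                              *)
From HB Require Import structures.
Require Import Defs.
From mathcomp Require Import all_boot all_order all_algebra all_field.

Set Implicit Arguments.
Unset Strict Implicit.
Unset Printing Implicit Defensive.

Import GRing.Theory.
Local Open Scope ring_scope.

(* The argument has two stages. In the first, a nonzero dimension t makes [Phi] trivial, so that the
   formula for the inverse antipode becomes S^-1 = S. In the sovereign case t is the trace on A of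
   left multiplication by Phi or by Phi^-1. Computing the trace in Sweedler notation with a factor
   that collapses to the counit, and applying cyclicity once, gives t q(1) = t q(Phi^-1) for every
   linear form q ([ftrace_mull_integral], [ftrace_mulr_integral]); hence Phi = 1
   ([sovereign_trivial]). In the cosovereign case t is the trace of e |-> Phi(e2) e1 or of e |->
   Phi(S e2) e1, and the same device gives t eps = t (Phi o S), respectively t eps = t Phi; either
   way Phi = eps ([cosovereign_trivial]).

   In the second stage S o S = 1, and traces provide integrals. The character lam of the regular
   representation is an integral on A with lam(1) = dim A, and the element Lam determined by q(Lam)
   = Tr(e |-> q(e2) e1) is an integral in A with eps(Lam) = dim A. Since dim A is nonzero in k, a
   linear projection onto a submodule can be averaged with Lam, and one onto a subcomodule with lam;
   the averaged maps are morphisms, and their kernels are the required complements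
   ([semisimple_of_involutive], [cosemisimple_of_involutive]). *)
Reserved Notation "\tsum_ ( x , y <- t ) E"
  (at level 41, x name, y name, E at level 41,
   format "'[' \tsum_ ( x ,  y  <-  t ) '/  '  E ']'").
(** With [t] of the form [comul a] or [rho v] this is a Sweedler sum. In the comments below a1, a2,
    ... are the Sweedler legs of a. *)
Notation "\tsum_ ( x , y <- t ) E" := (tlift (fun x y => E) t) : ring_scope.

(** * Linearity of composite expressions *)

Section Linearity.

Variables (k : fieldType) (U : lmodType k).

Lemma lin_id : linear (fun u : U => u).
Proof. by []. Qed.

Lemma lin_comp (V W : lmodType k) (g : {linear V -> W}) (f : U -> V) :
  linear f -> linear (fun u => g (f u)).
Proof. by move=> lf a u v; rewrite lf linearP. Qed.

Lemma lin_comp_fun (V W : lmodType k) (g : V -> W) (f : U -> V) :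
  linear g -> linear f -> linear (fun u => g (f u)).
Proof. by move=> lg lf a u v; rewrite lf lg. Qed.

Lemma linear_scale (V : lmodType k) (f : U -> V) :
  linear f -> forall a u, f (a *: u) = a *: f u.
Proof.
move=> lf; exact: (linearZ_LR (HB.pack f
  (GRing.isLinear.Build k U V *:%R _ lf) : {linear U -> V})).
Qed.

Lemma linear_bigsum (V : lmodType k) (f : U -> V) (I : finType) (F : I -> U) :
  linear f -> f (\sum_i F i) = \sum_i f (F i).
Proof.
move=> lf; exact: (linear_sum (HB.pack f
  (GRing.isLinear.Build k U V *:%R _ lf) : {linear U -> V})).
Qed.

Lemma lin_mull (B : algType k) (f : U -> B) b :
  linear f -> linear (fun u => f u * b).
Proof. by move=> lf a u v; rewrite lf mulrDl scalerAl. Qed.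

Lemma lin_mulr (B : algType k) (f : U -> B) b :
  linear f -> linear (fun u => b * f u).
Proof. by move=> lf a u v; rewrite lf mulrDr scalerAr. Qed.

Lemma lin_scalel (V : lmodType k) (f : U -> k^o) (v : V) :
  linear f -> linear (fun u => (f u : k) *: v).
Proof. by move=> lf a u w; rewrite lf scalerDl scalerA. Qed.

Lemma lin_scaler (V : lmodType k) (f : U -> V) (c : k) :
  linear f -> linear (fun u => c *: f u).
Proof. by move=> lf a u w; rewrite lf scalerDr !scalerA mulrC. Qed.

Lemma lin_lfun (V W : vectType k) (g : U -> 'Hom(V, W)) v :
  linear g -> linear (fun u => g u v).
Proof. by move=> lg a u w; rewrite lg add_lfunE scale_lfunE. Qed.

Lemma lin_tens (V W : vectType k) (f : U -> V) (w : W) :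
  linear f -> linear (fun u => f u ⊗ w).
Proof. by move=> lf a u v; rewrite lf; apply: (tens_bilin V W).1. Qed.

Lemma lin_tensr (V W : vectType k) (f : U -> W) (v : V) :
  linear f -> linear (fun u => v ⊗ f u).
Proof. by move=> lf a u w; rewrite lf; apply: (tens_bilin V W).2. Qed.

Lemma lin_tlift (V W : vectType k) (X : lmodType k) (beta : V -> W -> X)
    (f : U -> (V ⊗ W)%type) :
  linear f -> linear (fun u => tlift beta (f u)).
Proof. by move=> lf a u v; rewrite lf tlift_linear. Qed.

Lemma lin_tlift_fun (V W : vectType k) (X : lmodType k)
    (beta : U -> V -> W -> X) t :
  (forall v w, linear (fun u => beta u v w)) ->
  linear (fun u => tlift (beta u) t).
Proof.
move=> lb a u v; rewrite /tlift scaler_sumr -big_split; apply: eq_bigr => i _.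
rewrite scaler_sumr -big_split; apply: eq_bigr => j _ /=.
by rewrite lb scalerDr !scalerA mulrC.
Qed.

Lemma lin_bilinl (V W X : lmodType k) (T : V -> W -> X) (f : U -> V) w :
  bilin T -> linear f -> linear (fun u => T (f u) w).
Proof. by case=> lT _ lf a u v; rewrite lf lT. Qed.

Lemma lin_bilinr (V W X : lmodType k) (T : V -> W -> X) (f : U -> W) v :
  bilin T -> linear f -> linear (fun u => T v (f u)).
Proof. by case=> _ lT lf a u w; rewrite lf lT. Qed.

Lemma lin_sum (I : finType) (V : lmodType k) (f : I -> U -> V) :
  (forall i, linear (f i)) -> linear (fun u => \sum_i f i u).
Proof.
move=> lf a u v; rewrite scaler_sumr -big_split.
by apply: eq_bigr => i _; rewrite lf.
Qed.

End Linearity.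

Ltac lin := intros; repeat first
  [ assumption
  | match goal with H : _ |- _ => solve [apply: H] end
  | split; intros | apply: lin_id | apply: lin_mull
  | apply: lin_mulr | apply: lin_tens | apply: lin_tensr | apply: lin_tlift
  | apply: lin_tlift_fun; intros
  | apply: lin_scalel | apply: lin_scaler | apply: lin_lfun
  | apply: lin_sum; intros | apply: lin_comp
  | match goal with H : GRing.linear_for _ _ |- _ =>
      apply: (lin_comp_fun H) end
  | match goal with H : bilin _ |- _ =>
      first [apply: (lin_bilinl _ H) | apply: (lin_bilinr _ H)] end ].

(** * Calculus of maps out of tensor products *)

Section Tensors.

Variable k : fieldType.
Implicit Types U V W : vectType k.

Lemma eq_tlift U V (Y : lmodType k) (b c : U -> V -> Y) :
  (forall u v, b u v = c u v) -> forall t, tlift b t = tlift c t.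
Proof.
by move=> bc t; apply: eq_bigr => i _; apply: eq_bigr => j _; rewrite bc.
Qed.

Lemma linear_tlift U V (Y Z : lmodType k) (f : Y -> Z) (b : U -> V -> Y) t :
  linear f -> f (tlift b t) = tlift (fun u v => f (b u v)) t.
Proof.
move=> lf; rewrite (linear_bigsum _ lf); apply: eq_bigr => i _.
by rewrite (linear_bigsum _ lf); apply: eq_bigr => j _; rewrite linear_scale.
Qed.

Lemma tlift_exchange U V U' V' (Y : lmodType k) (b : U -> V -> U' -> V' -> Y)
    s t :
  tlift (fun u v => tlift (b u v) t) s =
  tlift (fun u' v' => tlift (fun u v => b u v u' v') s) t.
Proof.
rewrite /tlift.
under eq_bigr => i _ do under eq_bigr => j _ do rewrite scaler_sumr.
under eq_bigr => i _ do rewrite exchange_big /=.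
rewrite exchange_big /=; apply: eq_bigr => a _.
under eq_bigr => i _ do under eq_bigr => j _ do rewrite scaler_sumr.
under eq_bigr => i _ do rewrite exchange_big /=.
rewrite exchange_big /=; apply: eq_bigr => c _.
rewrite scaler_sumr; apply: eq_bigr => i _.
rewrite scaler_sumr; apply: eq_bigr => j _.
by rewrite !scalerA mulrC.
Qed.

Lemma tlift_ind U V (W : lmodType k) (f g : (U ⊗ V)%type -> W) :
  linear f -> linear g ->
  (forall u v, f (u ⊗ v) = g (u ⊗ v)) -> f =1 g.
Proof.
move=> lf lg fg.
pose F : {linear (U ⊗ V)%type -> W} :=
  HB.pack f (GRing.isLinear.Build k (U ⊗ V)%type W *:%R _ lf).
pose G : {linear (U ⊗ V)%type -> W} :=
  HB.pack g (GRing.isLinear.Build k (U ⊗ V)%type W *:%R _ lg).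
exact: (@tlift_unique k U V W F G fg).
Qed.

Lemma tlift_tmap U V U' V' (W : lmodType k) (b : U' -> V' -> W) (f : U -> U')
    (g : V -> V') t :
  bilin b -> linear f -> linear g ->
  tlift b (tmap f g t) = tlift (fun u v => b (f u) (g v)) t.
Proof.
move=> bb lf lg; move: t; apply: tlift_ind; [by lin| by lin|] => u v.
rewrite /tmap !tliftE //; last by lin.
by lin.
Qed.

Lemma tlift_tassoc U V W (X : lmodType k) (T : U -> V -> W -> X) t :
  (forall v w, linear (fun u => T u v w)) ->
  (forall u w, linear (fun v => T u v w)) ->
  (forall u v, linear (T u v)) ->
  tlift (fun u s => tlift (T u) s) (tassoc t) =
  tlift (fun s w => tlift (fun u v => T u v w) s) t.
Proof.
move=> l1 l2 l3; move: t; apply: tlift_ind; [by lin|by lin|] => s w.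
rewrite /tassoc !tliftE; [|by lin|by lin].
move: s; apply: tlift_ind; [by lin|by lin|] => u v.
by rewrite !tliftE; lin.
Qed.

End Tensors.

(** * Sweedler calculus for comodules *)

Section Coalgebras.

Variable k : fieldType.
Implicit Types (C : coalgType k) (V : vectType k).

Lemma tlift_basis (U V : vectType k) (Y : lmodType k) (b c : U -> V -> Y) t :
  (forall (i : 'I_(\dim {:U})) (j : 'I_(\dim {:V})),
    b (vbasis {:U})`_i (vbasis {:V})`_j =
               c (vbasis {:U})`_i (vbasis {:V})`_j) ->
  tlift b t = tlift c t.
Proof.
by move=> bc; apply: eq_bigr => i _; apply: eq_bigr => j _; rewrite bc.
Qed.

Lemma sum_coord_vbasis V (Y : lmodType k) (f : 'I_(\dim {:V}) -> Y)
    (i : 'I_(\dim {:V})) :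
  \sum_j (coord (vbasis {:V}) j (vbasis {:V})`_i : k) *: f j = f i.
Proof.
rewrite (bigD1 i) //= big1 ?addr0 => [|j ne].
  by rewrite coord_free ?(basis_free (vbasisP _)) // eqxx scale1r.
rewrite coord_free ?(basis_free (vbasisP _)) //.
by rewrite eq_sym (negbTE ne) scale0r.
Qed.

(* tlift only evaluates T at basis vectors, so T need not be multilinear. *)
Lemma comod_coassoc C V (rho : 'Hom(V, (V ⊗ C)%type)) (Y : lmodType k)
    (T : V -> C -> C -> Y) v :
  is_comodule rho ->
  \tsum_(u, c <- rho v) \tsum_(d, e <- comul c) T u d e =
  \tsum_(u, c <- rho v) \tsum_(w, d <- rho u) T w d c.
Proof.
case=> /(_ v) coassoc _.
pose T' u d e := \sum_i (coord (vbasis {:V}) i u : k) *: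
  \sum_j (coord (vbasis {:C}) j d : k) *:
  \sum_l (coord (vbasis {:C}) l e : k) *:
    T (vbasis {:V})`_i (vbasis {:C})`_j (vbasis {:C})`_l.
have TE (a : 'I_(\dim {:V})) (b c : 'I_(\dim {:C})) :
    T (vbasis {:V})`_a (vbasis {:C})`_b (vbasis {:C})`_c =
    T' (vbasis {:V})`_a (vbasis {:C})`_b (vbasis {:C})`_c.
  by rewrite /T' !sum_coord_vbasis.
have l1 d e : linear (fun u => T' u d e) by rewrite /T'; lin.
have l2 u e : linear (fun d => T' u d e) by rewrite /T'; lin.
have l3 u d : linear (T' u d) by rewrite /T'; lin.
transitivity (\tsum_(u, c <- rho v) \tsum_(d, e <- comul c) T' u d e).
  by apply: tlift_basis => i j; apply: tlift_basis => a b.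
transitivity (\tsum_(u, c <- rho v) \tsum_(w, d <- rho u) T' w d c); last first.
  by symmetry; apply: tlift_basis => i j; apply: tlift_basis => a b.
rewrite -(@tlift_tmap k V C V (C ⊗ C)%type _
  (fun u s => tlift (T' u) s) idfun comul);
  [|by lin|by lin|by lin].
rewrite -coassoc tlift_tassoc //.
rewrite tlift_tmap; [by []|by lin|by lin|by lin].
Qed.

Lemma comod_counit C V (rho : 'Hom(V, (V ⊗ C)%type)) (Y : lmodType k)
    (f : V -> Y) v :
  is_comodule rho -> linear f ->
  \tsum_(u, c <- rho v) ((counit c : k) *: f u) = f v.
Proof.
case=> _ /(_ v) counitr lf; rewrite -[in RHS]counitr /tunitr.
rewrite tlift_tmap; [|by lin|by lin|by lin].
rewrite (linear_tlift _ _ lf).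
by apply: eq_tlift => u c /=; rewrite (linear_scale lf).
Qed.

End Coalgebras.

(** * Sweedler calculus for Hopf algebras; the antipode reverses products and coproducts *)

Section HopfAlgebras.

Variables (k : fieldType) (A : hopfAlgType k).
Implicit Types (a b : A) (Y : lmodType k).

Local Notation S := (antipode : 'End(A)).
Local Notation eps := (counit : 'Hom(A, k^o)).

Lemma comul_coassoc Y (T : A -> A -> A -> Y) a :
  \tsum_(x, r <- comul a) \tsum_(y, z <- comul r) T x y z =
  \tsum_(r, z <- comul a) \tsum_(x, y <- comul r) T x y z.
Proof. exact: comod_coassoc (regular_comodule A). Qed.

Lemma tsum_counitr Y (f : A -> Y) a :
  linear f -> \tsum_(x, y <- comul a) ((eps y : k) *: f x) = f a.
Proof. exact: comod_counit (regular_comodule A). Qed.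

Lemma tsum_counitl Y (f : A -> Y) a :
  linear f -> \tsum_(x, y <- comul a) ((eps x : k) *: f y) = f a.
Proof.
move=> lf; rewrite -[in RHS](comul_counitl a) /tunitl.
rewrite tlift_tmap; [|by lin|by lin|by lin].
rewrite (linear_tlift _ _ lf).
by apply: eq_tlift => x y /=; rewrite (linear_scale lf).
Qed.

Lemma tsum_antipodel Y (f : A -> Y) a :
  linear f -> \tsum_(x, y <- comul a) f (S x * y) = (eps a : k) *: f 1.
Proof.
move=> lf; rewrite -(linear_scale lf) -(conv_antipodel a) /conv.
by rewrite (linear_tlift _ _ lf).
Qed.

Lemma tsum_antipoder Y (f : A -> Y) a :
  linear f -> \tsum_(x, y <- comul a) f (x * S y) = (eps a : k) *: f 1.
Proof.
move=> lf; rewrite -(linear_scale lf) -(conv_antipoder a) /conv.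
by rewrite (linear_tlift _ _ lf).
Qed.

Lemma tsum_comulM Y (T : A -> A -> Y) a b :
  bilin T ->
  \tsum_(x, y <- comul (a * b)) T x y =
  \tsum_(x, y <- comul a) \tsum_(z, w <- comul b) T (x * z) (y * w).
Proof.
move=> bT; rewrite comulM /tmul (linear_tlift _ _ (tlift_linear T)).
apply: eq_tlift => x y; rewrite (linear_tlift _ _ (tlift_linear T)).
by apply: eq_tlift => z w; rewrite tliftE.
Qed.

(** Uniqueness of convolution inverses: evaluate S(a1) a2 h(a3) by collapsing either pair of
    neighbours. *)
Lemma antipode_unique (h : A -> A) c :
  linear h ->
  (forall a, \tsum_(x, y <- comul a) (x * h y) = (eps a : k) *: c) ->
  forall a, h a = S a * c.
Proof.
move=> lh hc a.
have lSc : linear (fun x => S x * c) by lin.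
rewrite -(tsum_counitr _ lSc).
transitivity (\tsum_(x, r <- comul a) \tsum_(y, z <- comul r)
  (S x * (y * h z))).
  rewrite comul_coassoc -[LHS](tsum_counitl _ lh).
  apply: eq_tlift => r z; have lhz : linear (fun u => u * h z) by lin.
  rewrite -[X in _ *: X = _]mul1r -(tsum_antipodel r lhz).
  by apply: eq_tlift => x y; rewrite mulrA.
apply: eq_tlift => x r; rewrite scalerAr -hc linear_tlift //; lin.
Qed.

Lemma counitM_regular a b : eps (a * b) = (eps a : k) * (eps b : k).
Proof. exact: counitM. Qed.

Lemma antipodeM a b : S (a * b) = S b * S a.
Proof.
move: b; apply: antipode_unique => [|b]; first by lin.
(* Uniqueness is used a second time, now in the variable c: it applies because c1 b1 S(c2 b2) is the
   antipode axiom at c b. *)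
have E c : \tsum_(x, y <- comul b) (x * S (c * y)) = S c * ((eps b : k) *: 1).
  move: c; apply: antipode_unique; first by lin.
  move=> c.
  transitivity (\tsum_(z, w <- comul (c * b)) (z * S w)).
    rewrite tsum_comulM; last by lin.
    apply: eq_tlift => x y; rewrite linear_tlift; last by lin.
    by apply: eq_tlift => z w; rewrite mulrA.
  rewrite (@tsum_antipoder _ idfun); last by lin.
  by rewrite counitM_regular /= scalerA.
by rewrite E -scalerAr mulr1.
Qed.

Lemma antipode1 : S 1 = 1.
Proof.
have := conv_antipodel (1 : A); rewrite /conv comul1 tliftE; last by lin.
by rewrite mulr1 counit1 scale1r.
Qed.

(** Both sides are collapses of S(a1) a2 (S a4)_1 ⊗ a3 (S a4)_2: cancelling S(a1) a2 gives the left
    one, and recognising the coproduct of a2 S(a3) (after merging a2, a3) gives the right one. *)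
Lemma tsum_comul_antipode_half Y (T : A -> A -> Y) a :
  bilin T ->
  \tsum_(x, y <- comul a) \tsum_(u, v <- comul (S y)) T u (x * v) = T (S a) 1.
Proof.
move=> bT; have lTS : linear (fun x => T (S x) 1) by lin.
rewrite -[RHS](tsum_counitr a lTS).
transitivity (\tsum_(p, r <- comul a) \tsum_(y, z <- comul r)
    \tsum_(u, v <- comul (y * S z)) T (S p * u) v); last first.
  apply: eq_tlift => p r; rewrite (@tsum_antipoder _ (fun s =>
    \tsum_(u, v <- comul s) T (S p * u) v)); last by lin.
  by rewrite comul1 tliftE ?mulr1 //; lin.
transitivity (\tsum_(p, r <- comul a) \tsum_(y, z <- comul r)
    \tsum_(y1, y2 <- comul y) \tsum_(u, v <- comul (S z))
    T (S p * (y1 * u)) (y2 * v)); last first.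
  apply: eq_tlift => p r; apply: eq_tlift => y z.
  by rewrite tsum_comulM //; lin.
transitivity (\tsum_(p, r <- comul a) \tsum_(y1, s <- comul r)
    \tsum_(y2, z <- comul s) \tsum_(u, v <- comul (S z))
    T (S p * (y1 * u)) (y2 * v)); last first.
  by apply: eq_tlift => p r; rewrite comul_coassoc.
rewrite comul_coassoc.
have lQ : linear (fun s => \tsum_(y2, z <- comul s) \tsum_(u, v <- comul (S z))
    T u (y2 * v)) by lin.
rewrite -[LHS](tsum_counitl a lQ); apply: eq_tlift => r s.
rewrite tlift_exchange linear_tlift; last by lin.
apply: eq_tlift => y2 z; rewrite tlift_exchange linear_tlift; last by lin.
apply: eq_tlift => u v; under eq_tlift => x y do rewrite mulrA.
by rewrite (@tsum_antipodel _ (fun s => T (s * u) (y2 * v))) ?mul1r //; lin.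
Qed.

(** Insert S(a1) a2 in front of the second leg of the coproduct of S(a3); the previous lemma then
    absorbs a2 and leaves S(a1). *)
Lemma tsum_comul_antipode Y (T : A -> A -> Y) a :
  bilin T ->
  \tsum_(x, y <- comul (S a)) T x y = \tsum_(x, y <- comul a) T (S y) (S x).
Proof.
move=> bT.
transitivity (\tsum_(p, r <- comul a) \tsum_(x, y <- comul r)
    \tsum_(u, v <- comul (S y)) T u (S p * (x * v))).
  rewrite comul_coassoc.
  have lQ : linear (fun s => \tsum_(u, v <- comul (S s)) T u v) by lin.
  rewrite -[LHS](tsum_counitl a lQ); apply: eq_tlift => r s.
  rewrite tlift_exchange linear_tlift; last by lin.
  apply: eq_tlift => u v; under eq_tlift => x y do rewrite mulrA.
  by rewrite (@tsum_antipodel _ (fun a => T u (a * v))) ?mul1r //; lin.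
apply: eq_tlift => p r.
rewrite (@tsum_comul_antipode_half _ (fun u w => T u (S p * w))) ?mulr1 //; lin.
Qed.

(** * Antipode axioms for the inverse antipode, with the legs reversed *)

Section InverseAntipode.

Variable Si : 'End(A).
Hypotheses (SK : cancel S Si) (SiK : cancel Si S).

(** Applying the injective antihomomorphism S turns y S^-1(x) into x S(y), where the usual axiom
    applies. *)
Lemma tsum_antipode_invr Y (f : A -> Y) a :
  linear f -> \tsum_(x, y <- comul a) f (y * Si x) = (eps a : k) *: f 1.
Proof.
move=> lf; rewrite -(linear_scale lf) -(linear_tlift _ _ lf); congr f.
apply: (can_inj SK); rewrite linear_tlift; last by lin.
under eq_tlift => x y do rewrite antipodeM SiK.
by rewrite linearZ /= antipode1 (@tsum_antipoder _ idfun).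
Qed.

Lemma tsum_antipode_invl Y (f : A -> Y) a :
  linear f -> \tsum_(x, y <- comul a) f (Si y * x) = (eps a : k) *: f 1.
Proof.
move=> lf; rewrite -(linear_scale lf) -(linear_tlift _ _ lf); congr f.
apply: (can_inj SK); rewrite linear_tlift; last by lin.
under eq_tlift => x y do rewrite antipodeM SiK.
by rewrite linearZ /= antipode1 (@tsum_antipodel _ idfun).
Qed.

End InverseAntipode.

End HopfAlgebras.

(** * Traces of operators given by Sweedler sums *)

Section Traces.

Variable k : fieldType.
Implicit Types U V : vectType k.

(** A trace for plain functions, so that operators written as Sweedler sums need not be packaged as
    elements of ['End(V)]. *)
Definition ftrace V (f : V -> V) : k^o :=
  \sum_i coord (vbasis {:V}) i (f (vbasis {:V})`_i).

Lemma eq_ftrace V (f g : V -> V) : f =1 g -> ftrace f = ftrace g.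
Proof. by move=> fg; apply: eq_bigr => i _; rewrite fg. Qed.

Lemma ftraceC U V (f : U -> V) (g : V -> U) :
  linear f -> linear g -> ftrace (fun u => g (f u)) = ftrace (fun v => f (g v)).
Proof.
move=> lf lg; rewrite /ftrace; under eq_bigr => i _.
  rewrite {1}(coord_vbasis (memvf (f _))) (linear_bigsum _ lg) linear_sum /=.
  under eq_bigr => j _ do rewrite (linear_scale lg) linearZ /=.
  over.
rewrite exchange_big; apply: eq_bigr => j _ /=.
rewrite {2}(coord_vbasis (memvf (g (vbasis {:V})`_j))).
rewrite (linear_bigsum _ lf) linear_sum /=.
by apply: eq_bigr => i _; rewrite (linear_scale lf) linearZ /= [in RHS]mulrC.
Qed.

Lemma ftrace_tlift U V (W : vectType k) (F : U -> V -> W -> W) t :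
  ftrace (fun w => \tsum_(u, v <- t) F u v w) =
  \tsum_(u, v <- t) ftrace (F u v).
Proof.
rewrite /ftrace /tlift; under eq_bigr => i _ do rewrite linear_sum.
rewrite exchange_big /=; apply: eq_bigr => a _.
under eq_bigr => i _ do rewrite linear_sum.
rewrite exchange_big /=; apply: eq_bigr => b _.
by rewrite scaler_sumr; apply: eq_bigr => i _; rewrite linearZ.
Qed.

Lemma tlift_sum U V (Y : lmodType k) (I : finType) (F : I -> U -> V -> Y) t :
  \tsum_(u, v <- t) \sum_i F i u v = \sum_i \tsum_(u, v <- t) F i u v.
Proof.
rewrite /tlift; under eq_bigr => a _.
  under eq_bigr => b _ do rewrite scaler_sumr.
  rewrite exchange_big; over.
by rewrite exchange_big.
Qed.

Lemma ftrace_sum V (I : finType) (F : I -> V -> V) :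
  ftrace (fun v => \sum_i F i v) = \sum_i ftrace (F i).
Proof.
by rewrite exchange_big; apply: eq_bigr => i _; rewrite linear_sum.
Qed.

Lemma ftrace_scale V (f : V -> V) c :
  ftrace (fun v => c *: f v) = c *: ftrace f.
Proof. by rewrite scaler_sumr; apply: eq_bigr => i _; rewrite linearZ. Qed.

Lemma ftrace_id V : ftrace (fun v : V => v) = (\dim {:V})%:R.
Proof.
rewrite /ftrace; under eq_bigr => i _.
  by rewrite coord_free ?(basis_free (vbasisP _)) // eqxx; over.
by rewrite sumr_const card_ord.
Qed.

(** Testing against forms turns identities in A into scalar ones, whose coefficients can be moved in
    and out of a trace. *)
Lemma eq_forms V (v w : V) :
  (forall q : {linear V -> k^o}, q v = q w) -> v = w.
Proof.
move=> E; rewrite (coord_vbasis (memvf v)) (coord_vbasis (memvf w)).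
by apply: eq_bigr => i _; rewrite E.
Qed.

(* Cyclicity of the trace, moving the right leg of the coproduct through G. *)
Lemma ftrace_cut (C : coalgType k) (p : C -> C -> k) (G : C -> C) :
  linear G ->
  ftrace (fun b => \tsum_(x, y <- comul b)
    \tsum_(u, v <- comul (G y)) (p u x *: v)) =
  ftrace (fun c => \tsum_(u, w <- comul c)
    \tsum_(x, z <- comul w) (p u x *: G z)).
Proof.
move=> lG; pose e := vbasis {:C}.
(* The coproduct of b is the sum of e_i ⊗ [E i b]. The left operator is then a sum over i of
   composites of G o [E i] with c |-> p(c1, e_i) c2, and cyclicity applies to each summand. *)
pose E i (b : C) := \sum_j (comul b : 'M_(_, _)) i j *: e`_j.
have lE i : linear (E i).
  move=> a b c; rewrite scaler_sumr -big_split; apply: eq_bigr => j _.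
  by rewrite linearP /= !mxE scalerDl scalerA.
have tE (Y : lmodType k) (T : C -> C -> Y) b : (forall x, linear (T x)) ->
    \tsum_(x, y <- comul b) T x y = \sum_(i < \dim {:C}) T e`_i (E i b).
  move=> lT; apply: eq_bigr => i _; rewrite (linear_bigsum _ (lT _)).
  by apply: eq_bigr => j _; rewrite (linear_scale (lT _)).
under eq_ftrace => b.
  rewrite tE; last by lin.
  over.
rewrite ftrace_sum.
under eq_bigr => i _.
  rewrite (@ftraceC _ _ (fun b => G (E i b))
    (fun c => \tsum_(u, v <- comul c) (p u e`_i *: v))); [over|by lin|by lin].
rewrite -ftrace_sum; apply: eq_ftrace => c /=.
symmetry; under eq_tlift => u w.
  rewrite tE; last by lin.
  over.
rewrite tlift_sum; apply: eq_bigr => i _.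
have lGE : linear (fun b => G (E i b)) by lin.
rewrite [RHS](linear_tlift _ _ lGE).
by apply: eq_tlift => u v; rewrite (linear_scale lGE).
Qed.

End Traces.

Lemma scale_regularC (k : fieldType) (x y : k^o) : (x : k) *: y = (y : k) *: x.
Proof. exact: mulrC. Qed.

(** * Sovereign case: a nonzero trace makes the group-like element trivial *)

Section Sovereign.

Variables (k : fieldType) (A : hopfAlgType k) (Si : 'End(A)) (g : A).

Local Notation S := (antipode : 'End(A)).
Local Notation eps := (counit : 'Hom(A, k^o)).

Hypotheses (SK : cancel S Si) (SiK : cancel Si S).
Hypothesis gg : grouplike g.
Hypothesis SiE : forall x, Si x = g * S x * g^-1.

Let dg : comul g = g ⊗ g := gg.1.
Let ug : g \is a GRing.unit := (grouplike_unit gg).1.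
Let Sg : S g = g^-1 := esym (grouplike_unit gg).2.

(** Up to the factor g^-1, a |-> Tr(b |-> a b g) is an integral. A factor b2 S^-1(b1) is inserted
    inside q; after [ftrace_cut] it reappears as c1 S(c2) and collapses, leaving g^-1. The case a =
    1 serves [sovereign_trivial], the case g = 1 the averaging argument. *)
Lemma ftrace_mulr_integral a :
  \tsum_(x, y <- comul a) ((ftrace (fun b => y * b * g) : k) *: x) =
  (ftrace (fun b => a * b * g) : k) *: g^-1.
Proof.
apply: eq_forms => q; rewrite linear_tlift; last by lin.
(* For u = u' g this is q(u' S^-1(x)), because g is group-like and implements S^-1. *)
pose p (u x : A) : k := q (u * S x * g^-1).
have lG : linear (fun y => a * y * g) by lin.
have step b : \tsum_(x, y <- comul a) ((q x : k) *: (y * b * g)) =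
    \tsum_(x, y <- comul b) \tsum_(u, v <- comul (a * y * g)) (p u x *: v).
  transitivity (\tsum_(x, y <- comul b) \tsum_(a1, a2 <- comul a)
      \tsum_(y1, y2 <- comul y) ((q (a1 * (y1 * Si x)) : k) *: (a2 * y2 * g))).
    rewrite tlift_exchange; apply: eq_tlift => a1 a2.
    rewrite comul_coassoc.
    have lf : linear (fun b => (q a1 : k) *: (a2 * b * g)) by lin.
    rewrite -[LHS](tsum_counitl _ lf); apply: eq_tlift => r y2.
    have lf2 : linear (fun x => (q (a1 * x) : k) *: (a2 * y2 * g)) by lin.
    by rewrite (tsum_antipode_invr SK SiK _ lf2) mulr1.
  apply: eq_tlift => x y.
  rewrite [RHS]tsum_comulM; last by lin.
  rewrite [RHS]tsum_comulM; last by lin.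
  apply: eq_tlift => a1 a2; apply: eq_tlift => y1 y2.
  by rewrite dg tliftE ?/p ?SiE ?mulrA //; lin.
transitivity (ftrace (fun b =>
    \tsum_(x, y <- comul a) ((q x : k) *: (y * b * g)))).
  rewrite ftrace_tlift; apply: eq_tlift => x y.
  by rewrite linearZ ftrace_scale scale_regularC.
rewrite (eq_ftrace step) (ftrace_cut p lG) linearZ
  [RHS]scale_regularC -[RHS]ftrace_scale.
apply: eq_ftrace => c; rewrite comul_coassoc.
have lf : linear (fun c => (q g^-1 : k) *: (a * c * g)) by lin.
rewrite -[RHS](tsum_counitl _ lf); apply: eq_tlift => r z.
have lf2 : linear (fun u => (q (u * g^-1) : k) *: (a * z * g)) by lin.
by rewrite (tsum_antipoder _ lf2) mul1r.
Qed.

(** The inserted factor is S(b1) b2; after [ftrace_cut] it becomes S(c2) g^-1 c1 = g^-1 S^-1(c2) c1,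
    which collapses to g^-1. *)
Lemma ftrace_mull_integral (q : {linear A -> k^o}) :
  (ftrace (fun b => g * b) : k) *: q 1 =
  (ftrace (fun b => g * b) : k) *: q g^-1.
Proof.
pose p (u x : A) : k := q (S x * g^-1 * u).
have lG : linear (fun y => g * y) by lin.
have step b : (q 1 : k) *: (g * b) =
    \tsum_(x, y <- comul b) \tsum_(u, v <- comul (g * y)) (p u x *: v).
  have lf : linear (fun b => (q 1 : k) *: (g * b)) by lin.
  transitivity (\tsum_(x, y <- comul b)
      \tsum_(y1, y2 <- comul y) ((q (S x * y1) : k) *: (g * y2))).
    rewrite comul_coassoc -[LHS](tsum_counitl _ lf); apply: eq_tlift => r y2.
    have lf2 : linear (fun x => (q x : k) *: (g * y2)) by lin.
    by rewrite (tsum_antipodel _ lf2).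
  apply: eq_tlift => x y; rewrite tsum_comulM; last by lin.
  rewrite dg tliftE; last by lin.
  by apply: (@eq_tlift k) => y1 y2; rewrite /p mulrA mulrVK.
rewrite [LHS]scale_regularC [RHS]scale_regularC -!ftrace_scale (eq_ftrace step).
rewrite (ftrace_cut p lG); apply: eq_ftrace => c; rewrite comul_coassoc.
have lf : linear (fun c => (q g^-1 : k) *: (g * c)) by lin.
rewrite -[RHS](tsum_counitl _ lf); apply: eq_tlift => r z.
have lf2 : linear (fun u => (q (g^-1 * u) : k) *: (g * z)) by lin.
rewrite -[X in _ = _ *: (q X *: _)]mulr1 -(tsum_antipode_invl SK SiK _ lf2).
by apply: (@eq_tlift k) => u x; rewrite SiE !mulrA mulVr // mul1r.
Qed.

Lemma sovereign_trivial :
  ftrace (fun b => g * b) != 0 \/ ftrace (fun b => g^-1 * b) != 0 -> g = 1.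
Proof.
suff E (t : k) : t != 0 -> 
    (forall q : {linear A -> k^o}, t *: q 1 = t *: q g^-1) -> g = 1.
  case=> [nz|]; first exact: (E _ nz ftrace_mull_integral).
  (* Conjugation by S turns left multiplication by g^-1 = S(g) into right multiplication by g. *)
  have -> : ftrace (fun b => g^-1 * b) = ftrace (fun b => 1 * b * g).
    transitivity (ftrace (fun b => Si (g^-1 * S b))).
      rewrite (@ftraceC _ _ _ (fun b => g^-1 * S b) Si); [|by lin|by lin].
      by apply: eq_ftrace => b /=; rewrite SiK.
    apply: eq_ftrace => b; apply: (can_inj SK).
    by rewrite SiK mul1r antipodeM Sg.
  move=> nz; apply: (E _ nz) => q.
  have := congr1 q (ftrace_mulr_integral 1).
  by rewrite comul1 tliftE ?linearZ //; lin.
move=> nz qE; rewrite -[g]invrK -[RHS]invr1; congr (_^-1); symmetry.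
by apply: eq_forms => q; apply: (scalerI nz).
Qed.

End Sovereign.

(** * Cosovereign case: a nonzero trace makes the character trivial *)

Section Cosovereign.

Variables (k : fieldType) (A : hopfAlgType k) (Si : 'End(A)).
Variable Phi : {lrmorphism A -> k^o}.

Local Notation S := (antipode : 'End(A)).
Local Notation eps := (counit : 'Hom(A, k^o)).

Hypotheses (SK : cancel S Si) (SiK : cancel Si S).
Hypothesis SiPhi : forall a,
  \tsum_(x, y <- comul a) ((Phi y : k) *: Si x) =
  \tsum_(x, y <- comul a) ((Phi x : k) *: S y).

Let PhiM x y : Phi (x * y) = (Phi x : k) * (Phi y : k) := rmorphM Phi x y.
Let Phi1 : Phi 1 = 1 := rmorph1 Phi.

(** For functions on a group and phi the evaluation at a point, this is right translation by that
    point. Its traces for Phi and Phi o S are the two dimensions of the regular comodule. *)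
Definition rtrans (phi : A -> k^o) (e : A) : A :=
  \tsum_(u, v <- comul e) ((phi v : k) *: u).

(** As Phi is multiplicative, S(x2) [rtrans Phi](x1 e) Phi(S x3) contains Phi(x2) S(x3) after
    re-indexing; by [SiPhi] this is S^-1(x2) Phi(x3), and everything cancels to eps(x) [rtrans Phi]
    e. Under the trace, left multiplication by x1 moves to the front, where x1 S(x2) collapses and
    Phi(S x) remains. *)
Lemma ftrace_rtrans_integral x :
  (ftrace (rtrans Phi) : k) *: eps x = (ftrace (rtrans Phi) : k) *: Phi (S x).
Proof.
have step e : (eps x : k) *: rtrans Phi e =
    \tsum_(x1, r <- comul x) \tsum_(x2, x3 <- comul r)
      ((Phi (S x3) : k) *: (S x2 * rtrans Phi (x1 * e))).
  pose f w := \tsum_(u, v <- comul e) ((Phi v : k) *: (w * u)).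
  have lf : linear f by rewrite /f; lin.
  have -> : rtrans Phi e = f 1 by apply: eq_tlift => u v; rewrite mul1r.
  rewrite -(tsum_antipode_invl SK SiK _ lf).
  transitivity (\tsum_(a, y <- comul x) \tsum_(b, r <- comul y)
      \tsum_(x2, x3 <- comul r) ((Phi b * Phi (S x3) : k) *: f (S x2 * a))).
    apply: eq_tlift => a y; rewrite comul_coassoc.
    transitivity (\tsum_(s, z <- comul y) \tsum_(s1, t <- comul s)
        ((Phi t * Phi (S z) : k) *: f (Si s1 * a))); last first.
      apply: eq_tlift => s z.
      have lh : linear (fun w => (Phi (S z) : k) *: f (w * a)) by lin.
      have := congr1 (fun w => (Phi (S z) : k) *: f (w * a)) (SiPhi s).
      rewrite !(linear_tlift _ _ lh) => E.
      apply: etrans (etrans E _); apply: eq_tlift => u v;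
        by rewrite (linear_scale lh) scalerA.
    rewrite -comul_coassoc.
    have lg : linear (fun s => f (Si s * a)) by lin.
    rewrite -[LHS](tsum_counitr _ lg); apply: eq_tlift => s1 p.
    have lP : linear (fun w => (Phi w : k) *: f (Si s1 * a)) by lin.
    have := tsum_antipoder p lP; rewrite Phi1 scale1r => <-.
    by apply: eq_tlift => t z; rewrite PhiM.
  rewrite comul_coassoc; apply: eq_tlift => x1 r.
  transitivity (\tsum_(a, b <- comul x1) \tsum_(x2, x3 <- comul r)
      \tsum_(u, v <- comul e)
      ((Phi (S x3) : k) *: (S x2 * ((Phi (b * v) : k) *: (a * u))))).
    apply: eq_tlift => a b; apply: eq_tlift => x2 x3.
    rewrite /f linear_tlift; last by lin.
    apply: eq_tlift => u v.
    by rewrite PhiM -scalerAr !scalerA !mulrA [Phi b * Phi _]mulrC.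
  rewrite (@tlift_exchange k A A A A A); apply: eq_tlift => x2 x3.
  rewrite /rtrans tsum_comulM; last by lin.
  have lS : linear (fun w => (Phi (S x3) : k) *: (S x2 * w)) by lin.
  rewrite (linear_tlift _ _ lS); apply: eq_tlift => a b.
  by rewrite (linear_tlift _ _ lS).
rewrite [LHS]scale_regularC -ftrace_scale (eq_ftrace step) ftrace_tlift.
transitivity (ftrace (fun e =>
    \tsum_(x1, r <- comul x) \tsum_(x2, x3 <- comul r)
    ((Phi (S x3) : k) *: (x1 * S x2 * rtrans Phi e)))).
  rewrite ftrace_tlift; apply: eq_tlift => x1 r.
  rewrite !ftrace_tlift; apply: eq_tlift => x2 x3.
  rewrite !ftrace_scale; congr (_ *: _).
  rewrite (@ftraceC _ _ _ (fun e => x1 * e) (fun e => S x2 * rtrans Phi e)).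
  - by apply: eq_ftrace => e; rewrite mulrA.
  - by lin.
  - by rewrite /rtrans; lin.
rewrite scale_regularC -ftrace_scale; apply: eq_ftrace => e.
rewrite comul_coassoc.
have lh : linear (fun z => (Phi (S z) : k) *: rtrans Phi e) by lin.
rewrite -[RHS](tsum_counitl _ lh); apply: eq_tlift => r z.
have lf : linear (fun w => (Phi (S z) : k) *: (w * rtrans Phi e)) by lin.
by rewrite (tsum_antipoder _ lf) mul1r.
Qed.

(** The mirror image, with right multiplications: before the cyclic move Phi(S x2) Phi(x3) and then
    x1 S(x2) cancel; after it, [SiPhi] turns Phi(x2) S(x3) x1 into S^-1(x2) x1 Phi(x3), which leaves
    Phi(x). *)
Lemma ftrace_rtrans_antipode_integral x :
  (ftrace (rtrans (fun y => Phi (S y))) : k) *: eps x =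
  (ftrace (rtrans (fun y => Phi (S y))) : k) *: Phi x.
Proof.
set D := rtrans _.
have lD : linear D by rewrite /D /rtrans; lin.
have step e : (eps x : k) *: D e =
    \tsum_(x1, r <- comul x) \tsum_(x2, x3 <- comul r)
      ((Phi x2 : k) *: (D (e * x1) * S x3)).
  pose f w := \tsum_(u, v <- comul e) ((Phi (S v) : k) *: (u * w)).
  have lf : linear f by rewrite /f; lin.
  have -> : D e = f 1 by apply: eq_tlift => u v; rewrite mulr1.
  rewrite -(tsum_antipoder _ lf).
  transitivity (\tsum_(a, y <- comul x) \tsum_(b, r <- comul y)
      \tsum_(x2, x3 <- comul r) ((Phi (S b * x2) : k) *: f (a * S x3))).
    apply: eq_tlift => a y; rewrite comul_coassoc.
    have lg : linear (fun y => f (a * S y)) by lin.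
    rewrite -[LHS](tsum_counitl _ lg); apply: eq_tlift => r z.
    have lP : linear (fun w => (Phi w : k) *: f (a * S z)) by lin.
    by rewrite (tsum_antipodel _ lP) Phi1 scale1r.
  rewrite comul_coassoc; apply: eq_tlift => x1 r.
  rewrite tlift_exchange; apply: eq_tlift => x2 x3.
  have lS : linear (fun w => (Phi x2 : k) *: (w * S x3)) by lin.
  rewrite /D /rtrans tsum_comulM; last by lin.
  rewrite tlift_exchange (linear_tlift _ _ lS); apply: eq_tlift => a b.
  rewrite (linear_tlift _ _ lS) /f linear_tlift; last by lin.
  apply: eq_tlift => u v.
  by rewrite antipodeM !PhiM -scalerAl !scalerA !mulrA [Phi x2 * Phi _]mulrC.
rewrite [LHS]scale_regularC -ftrace_scale (eq_ftrace step) ftrace_tlift.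
transitivity (ftrace (fun e =>
    \tsum_(x1, r <- comul x) \tsum_(x2, x3 <- comul r)
    ((Phi x2 : k) *: (D e * (S x3 * x1))))).
  rewrite ftrace_tlift; apply: eq_tlift => x1 r.
  rewrite !ftrace_tlift; apply: eq_tlift => x2 x3.
  rewrite !ftrace_scale; congr (_ *: _).
  rewrite (@ftraceC _ _ _ (fun e => e * x1) (fun e => D e * S x3));
    [|by lin|by lin].
  by apply: eq_ftrace => e; rewrite mulrA.
rewrite scale_regularC -ftrace_scale; apply: eq_ftrace => e.
transitivity (\tsum_(x1, r <- comul x) \tsum_(s, t <- comul r)
    ((Phi t : k) *: (D e * (Si s * x1)))).
  apply: eq_tlift => x1 r.
  have lh : linear (fun w => D e * (w * x1)) by lin.
  have := congr1 (fun w => D e * (w * x1)) (SiPhi r).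
  rewrite !(linear_tlift _ _ lh) => E.
  apply: etrans (etrans (esym E) _); apply: eq_tlift => u v;
    by rewrite (linear_scale lh).
rewrite comul_coassoc.
have lh : linear (fun z => (Phi z : k) *: D e) by lin.
rewrite -[RHS](tsum_counitl _ lh); apply: eq_tlift => r z.
have lf : linear (fun w => (Phi z : k) *: (D e * w)) by lin.
by rewrite (tsum_antipode_invl SK SiK _ lf) mulr1.
Qed.

Lemma cosovereign_trivial :
  ftrace (rtrans Phi) != 0 \/ ftrace (rtrans (fun y => Phi (S y))) != 0 ->
  forall x, Phi x = eps x.
Proof.
case=> nz x; last first.
  by apply: (scalerI nz); rewrite -ftrace_rtrans_antipode_integral.
have PhiS y : Phi (S y) = eps y.
  by apply: (scalerI nz); rewrite -ftrace_rtrans_integral.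
have lPhi : linear (fun y => Phi y) by lin.
rewrite -[LHS](tsum_counitr x lPhi).
transitivity (\tsum_(y, z <- comul x) Phi (y * S z)).
  by apply: eq_tlift => y z; rewrite PhiM PhiS mulrC.
by rewrite (tsum_antipoder x lPhi) Phi1 [LHS]mulr1.
Qed.

End Cosovereign.

(** * Complements from projections, and membership in tensor products of subspaces *)

Section Complements.

Variable k : fieldType.
Implicit Types U V : vectType k.

Lemma lfun_of_linear U V (f : U -> V) :
  linear f -> exists F : 'Hom(U, V), F =1 f.
Proof.
move=> lf; pose F : {linear U -> V} :=
  HB.pack f (GRing.isLinear.Build k U V *:%R _ lf).
by exists (linfun F) => u; rewrite lfunE.
Qed.

Lemma has_complement_proj V (stable : {vspace V} -> Prop) (P : 'End(V))
    (W : {vspace V}) :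
  (forall v, P v \in W) -> {in W, forall w, P w = w} -> stable (lker P) ->
  has_complement stable W.
Proof.
move=> PW idP sP; exists (lker P); split=> //.
  apply/eqP; rewrite eqEsubv subvf; apply/subvP=> v _.
  rewrite -[v](subrK (P v)) addrC memv_add // memv_ker linearB /=.
  by rewrite [P (P v)]idP // subrr.
apply/eqP; rewrite -subv0; apply/subvP=> v; rewrite memv_cap memv_ker memv0.
by case/andP=> Wv; rewrite idP.
Qed.

Lemma mem_tensv U V (U' : {vspace U}) (V' : {vspace V}) u v :
  u \in U' -> v \in V' -> u ⊗ v \in tensv U' V'.
Proof.
move=> U'u V'v; rewrite (coord_vbasis U'u) (coord_vbasis V'v).
have lu (w : V) : linear (fun u : U => u ⊗ w) by lin.
have lv (w : U) : linear (fun v : V => w ⊗ v) by lin.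
rewrite (linear_bigsum _ (lu _)); apply: memv_suml => i _.
rewrite (linear_bigsum _ (lv _)); apply: memv_suml => j _.
rewrite (linear_scale (lu _)) (linear_scale (lv _)) !memvZ // memv_span //.
apply/allpairsP; exists ((vbasis U')`_i, (vbasis V')`_j).
by rewrite !mem_nth ?size_tuple.
Qed.

Lemma memv_tlift U V (W' : vectType k) (X : {vspace W'}) (b : U -> V -> W') t :
  (forall u v, b u v \in X) -> tlift b t \in X.
Proof.
by move=> bX; apply: memv_suml => i _; apply: memv_suml => j _; rewrite memvZ.
Qed.

Lemma tensv_memv U V (W' : vectType k) (X : {vspace W'})
    (f : (U ⊗ V)%type -> W')
    (U' : {vspace U}) (V' : {vspace V}) :
  linear f -> (forall u v, u \in U' -> f (u ⊗ v) \in X) ->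
  {in tensv U' V', forall t, f t \in X}.
Proof.
move=> lf fX t; have [F FE] := lfun_of_linear lf.
suff /subvP/(_ t) sF : (tensv U' V' <= F @^-1: X)%VS.
  by move/sF; rewrite -memv_preim FE.
apply/span_subvP=> _ /allpairsP[[u v] [/= Uu _ ->]].
by rewrite -memv_preim FE fX ?vbasis_mem.
Qed.

Lemma tensv_ind U V (W' : vectType k) (f g : (U ⊗ V)%type -> W')
    (U' : {vspace U}) (V' : {vspace V}) :
  linear f -> linear g ->
  (forall u v, u \in U' -> f (u ⊗ v) = g (u ⊗ v)) ->
  {in tensv U' V', f =1 g}.
Proof.
move=> lf lg fg t tUV; apply/eqP; rewrite -subr_eq0 -memv0.
move: t tUV; apply: tensv_memv => [a s t|u v Uu]; last first.
  by rewrite memv0 subr_eq0 fg.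
by rewrite lf lg opprD addrACA scalerBr.
Qed.

End Complements.

(** * Integrals from traces and averaging, when S o S = 1 *)

Section Maschke.

Variables (k : fieldType) (A : hopfAlgType k).

Local Notation S := (antipode : 'End(A)).
Local Notation eps := (counit : 'Hom(A, k^o)).
Local Notation d := ((\dim {:A})%:R : k).

Hypothesis SS : forall a : A, S (S a) = a.
Hypothesis d_neq0 : d != 0.

(** The character of the regular representation. *)
Let lam (a : A) : k^o := ftrace (fun b => a * b).
(** The dual trace, written as an element of A; [formLam] is its characterisation. *)
Let Lam : A := \sum_(i < \dim {:A})
  \tsum_(u, v <- comul (vbasis {:A})`_i) ((coord (vbasis {:A}) i u : k) *: v).

Let lin_lam : linear lam.
Proof.
move=> c u v; rewrite -ftrace_scale /lam /ftrace -big_split.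
apply: eq_bigr => i _.
by rewrite mulrDl linearD -scalerAl.
Qed.

Let lam1 : lam 1 = d.
Proof. by rewrite -ftrace_id; apply: eq_ftrace => b; rewrite mul1r. Qed.

Let lam_integral a :
  \tsum_(x, y <- comul a) ((lam y : k) *: x) = (lam a : k) *: 1.
Proof.
have gg : grouplike (1 : A) by split; [exact: comul1 | exact: counit1].
have SE x : S x = 1 * S x * 1^-1 by rewrite invr1 mulr1 mul1r.
have := ftrace_mulr_integral SS SS gg SE a; rewrite invr1 /lam.
rewrite (@eq_ftrace _ _ (fun b => a * b * 1) (fun b => a * b)); last first.
  by move=> b; rewrite mulr1.
move=> <-; apply: eq_tlift => x y; congr (_ *: _).
by apply: eq_ftrace => b; rewrite mulr1.
Qed.

Let formLam (q : {linear A -> k^o}) : q Lam = ftrace (rtrans q).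
Proof.
rewrite linear_sum; apply: eq_bigr => i _.
rewrite linear_tlift; last by lin.
have lc : linear (fun w : A => coord (vbasis {:A}) i w : k^o) by lin.
rewrite /rtrans [RHS](linear_tlift _ _ lc).
by apply: eq_tlift => u v; rewrite !linearZ; apply: mulrC.
Qed.

Let epsLam : eps Lam = d.
Proof.
rewrite formLam -ftrace_id; apply: eq_ftrace => b.
by rewrite /rtrans (@tsum_counitr _ _ _ idfun).
Qed.

(** Tested on q, the left side is the trace of e |-> q(x e2) e1, which equals S(x1) [rtrans q](x2
    e). Cyclicity produces x2 S(x1), and this collapses because S is its own inverse. *)
Let Lam_integral x : x * Lam = (eps x : k) *: Lam.
Proof.
apply: eq_forms => q; rewrite linearZ /=.
have lqx : linear (fun v => q (x * v)) by lin.
pose qx : {linear A -> k^o} := HB.pack (fun v => q (x * v))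
  (GRing.isLinear.Build k A k^o *:%R _ lqx).
rewrite -[LHS]/(qx Lam) !formLam.
have lq : linear (rtrans q) by rewrite /rtrans; lin.
have step e : rtrans qx e =
    \tsum_(x1, x2 <- comul x) (S x1 * rtrans q (x2 * e)).
  transitivity (\tsum_(x1, r <- comul x) \tsum_(y, z <- comul r)
      \tsum_(u, v <- comul e) ((q (z * v) : k) *: (S x1 * y * u))).
    rewrite comul_coassoc.
    have lh : linear (fun z => \tsum_(u, v <- comul e) ((q (z * v) : k) *: u)).
      by lin.
    rewrite -[LHS](tsum_counitl x lh); apply: eq_tlift => s z.
    rewrite tlift_exchange linear_tlift; last by lin.
    apply: eq_tlift => u v.
    have lf : linear (fun w => (q (z * v) : k) *: (w * u)) by lin.
    by rewrite (tsum_antipodel _ lf) mul1r.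
  apply: eq_tlift => x1 r; rewrite /rtrans tsum_comulM; last by lin.
  have lS : linear (fun w => S x1 * w) by lin.
  rewrite (linear_tlift _ _ lS); apply: eq_tlift => y z.
  rewrite (linear_tlift _ _ lS); apply: eq_tlift => u v.
  by rewrite -scalerAr mulrA.
rewrite (eq_ftrace step) ftrace_tlift -ftrace_scale.
transitivity (ftrace (fun e =>
    \tsum_(x1, x2 <- comul x) (x2 * S x1 * rtrans q e))).
  rewrite ftrace_tlift; apply: eq_tlift => x1 x2.
  rewrite (@ftraceC _ _ _ (fun e => x2 * e) (fun e => S x1 * rtrans q e));
    [|by lin|by lin].
  by apply: eq_ftrace => e; rewrite mulrA.
apply: eq_ftrace => e.
have lf : linear (fun w => w * rtrans q e) by lin.
by rewrite (tsum_antipode_invr SS SS _ lf) mul1r.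
Qed.

(** Maschke's argument: Q v is the average of Lam1 P(S(Lam2) v). On W it is multiplication by Lam1
    S(Lam2) = eps(Lam) = dim A, divided by dim A. *)
Lemma semisimple_of_involutive : semisimple A.
Proof.
move=> V rho [lrho rho1 rhoM] W sW.
have rhoME a b v : rho (a * b) v = rho a (rho b v) by rewrite rhoM comp_lfunE.
have rhoW a w : w \in W -> rho a w \in W.
  by move=> Ww; apply: (subvP (sW a)); rewrite memv_img.
pose P := projv W.
pose Q v : V := d^-1 *: \tsum_(x, y <- comul Lam) rho x (P (rho (S y) v)).
have lQ : linear Q by rewrite /Q; lin.
have bQ v : bilin (fun x y => rho x (P (rho (S y) v))) by lin.
have QM a v : rho a (Q v) = Q (rho a v).
  rewrite /Q linearZ /=; congr (_ *: _); rewrite linear_tlift; last by lin.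
  (* In this middle term a1 Lam can be absorbed by the integral property, which gives Q(a v); or its
     coproduct is expanded and S(a2) a3 cancels, which gives a Q(v). *)
  transitivity (\tsum_(a1, a2 <- comul a) \tsum_(x, y <- comul (a1 * Lam))
      rho x (P (rho (S y * a2) v))); last first.
    have lf : linear (fun a2 => \tsum_(x, y <- comul Lam)
      rho x (P (rho (S y * a2) v))) by lin.
    transitivity (\tsum_(x, y <- comul Lam) rho x (P (rho (S y * a) v))).
      rewrite -[RHS](tsum_counitl _ lf); apply: eq_tlift => a1 a2.
      by rewrite Lam_integral linearZ /= linearZ.
    by apply: eq_tlift => x y; rewrite rhoME.
  transitivity (\tsum_(a1, a2 <- comul a) \tsum_(b, c <- comul a1)
      \tsum_(x, y <- comul Lam) rho (b * x) (P (rho (S y * (S c * a2)) v))).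
    rewrite -comul_coassoc.
    have lf : linear (fun a => \tsum_(x, y <- comul Lam)
      rho (a * x) (P (rho (S y) v))) by lin.
    transitivity (\tsum_(x, y <- comul Lam) rho (a * x) (P (rho (S y) v))).
      by apply: eq_tlift => x y; rewrite rhoME.
    rewrite -[LHS](tsum_counitr _ lf); apply: eq_tlift => b r.
    rewrite tlift_exchange linear_tlift; last by lin.
    apply: eq_tlift => x y.
    have lg : linear (fun w => rho (b * x) (P (rho (S y * w) v))) by lin.
    by rewrite (tsum_antipodel _ lg) mulr1.
  apply: eq_tlift => a1 a2; rewrite tsum_comulM; last by lin.
  by do 2![apply: eq_tlift => ? ?]; rewrite antipodeM mulrA.
have [F QE] := lfun_of_linear lQ.
apply: (@has_complement_proj _ _ _ F); [| |] => [v|w Ww|a].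
- rewrite QE memvZ // memv_tlift // => x y; exact/rhoW/memv_proj.
- rewrite QE /Q.
  have lf : linear (fun a => rho a w) by lin.
  under eq_tlift => x y do rewrite projv_id ?rhoW // -rhoME.
  rewrite (tsum_antipoder _ lf) epsLam rho1 lfunE /= scalerA mulVf //.
  by rewrite scale1r.
apply/subvP=> _ /memv_imgP[v kv ->]; move: kv; rewrite !memv_ker !QE -QM.
by move/eqP->; rewrite linear0.
Qed.

(** Apply [lam_integral] to e S(c1) and multiply by c2: since S reverses the coproduct, a factor
    S(c2) c3 appears and cancels. This is the dual of moving a across Lam1 ⊗ S(Lam2), and makes the
    averaged map colinear. *)
Let lam_strong_invariance (Y : lmodType k) (f : A -> Y) (e c : A) : linear f ->
  \tsum_(b, e' <- comul e) ((lam (e' * S c) : k) *: f b) =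
  \tsum_(c', c'' <- comul c) ((lam (e * S c') : k) *: f c'').
Proof.
move=> lf; symmetry.
transitivity (\tsum_(c', c'' <- comul c) \tsum_(b, e' <- comul e)
    \tsum_(p, q <- comul c') ((lam (e' * S p) : k) *: f (b * S q * c''))).
  apply: eq_tlift => c' c''.
  have lg : linear (fun w => f (w * c'')) by lin.
  have := congr1 (fun w => f (w * c'')) (lam_integral (e * S c')).
  rewrite (linear_scale lg) mul1r => <-; rewrite (linear_tlift _ _ lg).
  rewrite tsum_comulM; last by lin.
  apply: eq_tlift => b e'; rewrite tsum_comul_antipode; last by lin.
  by apply: eq_tlift => p q; rewrite (linear_scale lg).
rewrite tlift_exchange; apply: eq_tlift => b e'.
rewrite -comul_coassoc.
have lg : linear (fun p => (lam (e' * S p) : k) *: f b) by lin.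
rewrite -[RHS](tsum_counitr _ lg); apply: eq_tlift => p r.
have lh : linear (fun w => (lam (e' * S p) : k) *: f (b * w)) by lin.
rewrite -[X in _ = _ *: (_ *: f X)]mulr1 -(tsum_antipodel _ lh).
by apply: eq_tlift => q c''; rewrite mulrA.
Qed.

(** Dual averaging: the coefficients of P(v0) and the antipode of v1 are paired by lam. On W this
    gives lam(w1 S(w2)) w0 = lam(1) w = (dim A) w, divided by dim A. *)
Lemma cosemisimple_of_involutive : cosemisimple A.
Proof.
move=> V rho crho W sW.
have rhoW w : w \in W -> rho w \in tensv W {:A}.
  by move=> Ww; apply: (subvP sW); rewrite memv_img.
pose P := projv W.
pose Q v : V := d^-1 *: \tsum_(u, c <- rho v)
  \tsum_(w, e <- rho (P u)) ((lam (e * S c) : k) *: w).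
have lQ : linear Q by rewrite /Q; lin.
(* Colinearity of Q, tested against bilinear maps; strong invariance moves the coproduct from the
   coefficient of P u to that of v. *)
have Qcolin (Y : lmodType k) (T : V -> A -> Y) v : bilin T ->
    \tsum_(u, c <- rho (Q v)) T u c = \tsum_(u, c <- rho v) T (Q u) c.
  move=> bT; rewrite /Q.
  have lT : linear (fun v => \tsum_(u, c <- rho v) T u c) by lin.
  have lT1 c : linear (fun u => T u c) by lin.
  rewrite (linear_scale lT) (linear_tlift _ _ lT).
  under [RHS]eq_tlift => u c do rewrite (linear_scale (lT1 _)).
  rewrite -[RHS]linear_tlift; last by lin.
  congr (_ *: _).
  transitivity (\tsum_(u, c <- rho v) \tsum_(a, s <- rho (P u))
      \tsum_(c', c'' <- comul c) ((lam (s * S c') : k) *: T a c'')).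
    apply: eq_tlift => u c; rewrite (linear_tlift _ _ lT).
    transitivity (\tsum_(a, s <- rho (P u)) \tsum_(b, e <- comul s)
        ((lam (e * S c) : k) *: T a b)).
      rewrite comod_coassoc //; apply: eq_tlift => w e.
      rewrite (linear_scale lT) linear_tlift //; lin.
    apply: eq_tlift => a s; apply: lam_strong_invariance; lin.
  transitivity (\tsum_(u, c <- rho v) \tsum_(c', c'' <- comul c)
      \tsum_(w, e <- rho (P u)) ((lam (e * S c') : k) *: T w c'')).
    by apply: eq_tlift => u c; rewrite tlift_exchange.
  rewrite comod_coassoc //; apply: eq_tlift => u c.
  rewrite [RHS](linear_tlift _ _ (lT1 c)); apply: eq_tlift => u' c'.
  rewrite [RHS](linear_tlift _ _ (lT1 c)); apply: eq_tlift => w e.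
  by rewrite (linear_scale (lT1 c)).
have QW v : Q v \in W.
  rewrite memvZ // memv_tlift // => u c.
  move: (rhoW _ (memv_proj W u)); move: (rho _).
  apply: tensv_memv; first by lin.
  by move=> w e Ww; rewrite tliftE; [rewrite memvZ|lin].
have Qid w : w \in W -> Q w = w.
  move=> Ww; rewrite /Q.
  transitivity (d^-1 *: \tsum_(u, c <- rho w)
      \tsum_(w', e <- rho u) ((lam (e * S c) : k) *: w')).
    congr (_ *: _); move: (rho w) (rhoW w Ww).
    apply: tensv_ind; [by lin|by lin|].
    by move=> u c Wu; rewrite !tliftE; [rewrite /P projv_id|lin|lin].
  rewrite -comod_coassoc //.
  have lf : linear (fun w' : V => d *: w') by lin.
  transitivity (d^-1 *: (d *: w)); last by rewrite scalerA mulVf ?scale1r.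
  rewrite -(comod_counit _ crho lf); congr (_ *: _); apply: eq_tlift => w' r.
  have lg : linear (fun a => (lam a : k) *: w') by lin.
  by rewrite (tsum_antipoder _ lg) lam1.
have [F QE] := lfun_of_linear lQ.
apply: (@has_complement_proj _ _ _ F); [| |] => [v|w Ww|];
  rewrite ?QE ?QW ?Qid //.
apply/subvP=> _ /memv_imgP[v kv ->]; move: kv; rewrite memv_ker QE => /eqP Qv0.
(* Colinearity and Q v = 0 make the subtracted sum vanish; each u - Q u lies in the kernel because Q
   is idempotent. *)
have -> : rho v = \tsum_(u, c <- rho v) ((u - Q u) ⊗ c).
  have E : \tsum_(u, c <- rho v) (Q u ⊗ c) = 0.
    rewrite -(@Qcolin _ (fun u c => u ⊗ c)); last by lin.
    by rewrite Qv0 !linear0.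
  rewrite -[LHS]subr0 -E {1}(tens_sum (rho v)) /tlift -sumrB.
  apply: eq_bigr => i _; rewrite -sumrB; apply: eq_bigr => j _.
  rewrite -scalerBr; congr (_ *: _).
  have lt : linear (fun u => u ⊗ (vbasis {:A})`_j) by lin.
  by rewrite -[in RHS]scaleN1r [in RHS]addrC lt scaleN1r addrC.
apply: memv_tlift => u c; apply: mem_tensv; last exact: memvf.
by rewrite memv_ker linearB /= !QE (Qid _ (QW _)) subrr.
Qed.

End Maschke.

(** * Dimensions as traces, and involutivity of the antipode *)

Section Involutivity.

Variables (k : fieldType) (A : hopfAlgType k).

Local Notation S := (antipode : 'End(A)).
Local Notation eps := (counit : 'Hom(A, k^o)).

Lemma antipode_invK : bijective (antipode : A -> A) ->
  cancel S (S^-1)%VF /\ cancel (S^-1)%VF S.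
Proof.
move=> /bij_inj injS; have kerS : lker S == 0%VS by apply/lker0P.
by split; [exact: lker0_lfunK | exact: lker0_lfunVK].
Qed.

Lemma comod_diml_comul (Phi : {lrmorphism A -> k^o}) :
  comod_diml Phi (comul : 'Hom(A, (A ⊗ A)%type)) = ftrace (rtrans Phi).
Proof.
apply: eq_bigr => i _; rewrite /comod_coef /rtrans.
have lP : linear (fun y => Phi y) by lin.
have lc : linear (fun w : A => coord (vbasis {:A}) i w : k^o) by lin.
rewrite (linear_tlift _ _ lP) (linear_tlift _ _ lc).
by refine (@eq_tlift k A A k^o _ _ _ _) => u v; rewrite !linearZ; apply: mulrC.
Qed.

Lemma comod_dimr_comul (Phi : {lrmorphism A -> k^o}) :
  comod_dimr Phi (comul : 'Hom(A, (A ⊗ A)%type)) =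
  ftrace (rtrans (fun y => Phi (S y))).
Proof.
apply: eq_bigr => i _; rewrite /comod_coef /rtrans.
have lP : linear (fun y => Phi (S y)) by lin.
have lc : linear (fun w : A => coord (vbasis {:A}) i w : k^o) by lin.
rewrite (linear_tlift _ _ lP) (linear_tlift _ _ lc).
by refine (@eq_tlift k A A k^o _ _ _ _) => u v; rewrite !linearZ; apply: mulrC.
Qed.

Lemma cosovereign_involutive (Phi : {lrmorphism A -> k^o}) :
  cosovereign Phi ->
  comod_diml Phi (comul : 'Hom(A, (A ⊗ A)%type)) != 0 \/
  comod_dimr Phi (comul : 'Hom(A, (A ⊗ A)%type)) != 0 ->
  forall a, S (S a) = a.
Proof.
rewrite comod_diml_comul comod_dimr_comul.
case=> /antipode_invK[SK SiK] [Psi [PsiP SiE]] nz.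
(* Convolving S^-1 = Phi * S * Psi on the right with Phi cancels Psi and gives S^-1 * Phi = Phi *
   S. *)
have SiPhi a : \tsum_(x, y <- comul a) ((Phi y : k) *: (S^-1)%VF x) =
    \tsum_(x, y <- comul a) ((Phi x : k) *: S y).
  pose M m := conv (fun x => (Phi x)%:A) S m.
  have lM : linear M by rewrite /M /conv; lin.
  transitivity (\tsum_(m, p <- comul a) \tsum_(z, y <- comul p)
      ((Psi z * Phi y : k) *: M m)).
    rewrite comul_coassoc; apply: eq_tlift => x y.
    rewrite SiE /conv linear_tlift; last by lin.
    apply: eq_tlift => m z.
    by rewrite -scalerAr mulr1 scalerA mulrC.
  transitivity (M a); last first.
    by apply: eq_tlift => x y; rewrite -scalerAl mul1r.
  rewrite -(tsum_counitr a lM); apply: eq_tlift => m p.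
  have lm : linear (fun c : k^o => (c : k) *: M m) by lin.
  have := congr1 (fun c : k^o => (c : k) *: M m) (PsiP p).2.
  rewrite /conv (linear_tlift _ _ lm) => ->.
  by congr (_ *: _); apply: mulr1.
have Phi_eps := cosovereign_trivial SK SiK SiPhi nz.
move=> a; rewrite -[RHS]SiK; congr (S _).
have lS : linear (fun x => S x) by lin.
have lSi : linear (fun x => (S^-1)%VF x) by lin.
rewrite -(tsum_counitl a lS) -[RHS](tsum_counitr a lSi).
under eq_tlift => x y do rewrite -Phi_eps.
by rewrite -SiPhi; apply: eq_tlift => x y; rewrite Phi_eps.
Qed.

Lemma mod_diml_amull (g : A) :
  mod_diml g (fun a : A => amull a) = ftrace (fun b => g * b).
Proof.
rewrite /mod_diml (lftraceE _ (vbasisP {:A})).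
by apply: eq_bigr => i _; rewrite lfunE.
Qed.

Lemma sovereign_involutive (g : A) :
  sovereign g ->
  mod_diml g (fun a : A => amull a) != 0 \/
  mod_dimr g (fun a : A => amull a) != 0 ->
  forall a, S (S a) = a.
Proof.
rewrite /mod_dimr -[lftrace _]/(mod_diml _ _) !mod_diml_amull.
case=> /antipode_invK[SK SiK] gg SiE nz a.
have g1 := sovereign_trivial SK SiK gg SiE nz.
by rewrite -[RHS]SiK SiE g1 invr1 mul1r mulr1.
Qed.

End Involutivity.

Theorem theorem5p1 (k : fieldType) (char0 : [pchar k] =i pred0)
    (A : hopfAlgType k) :
  (forall Phi : {lrmorphism A -> k^o}, cosovereign Phi ->
     comod_diml Phi (comul : 'Hom(A, (A ⊗ A)%type)) != 0 \/
     comod_dimr Phi (comul : 'Hom(A, (A ⊗ A)%type)) != 0 ->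
     [/\ forall a : A, antipode (antipode a) = a,
         semisimple A & cosemisimple A]) /\
  (forall Phi : A, sovereign Phi ->
     mod_diml Phi (fun a : A => amull a) != 0 \/
     mod_dimr Phi (fun a : A => amull a) != 0 ->
     [/\ forall a : A, antipode (antipode a) = a,
         semisimple A & cosemisimple A]).
Proof.
(* Characteristic zero enters here: dim A is a positive integer, hence invertible in k. *)
have d_neq0 : (\dim {:A})%:R != 0 :> k.
  by rewrite (pcharf0P _).1 // -lt0n adim_gt0.
split=> Phi sPhi nz.
  have SS := cosovereign_involutive sPhi nz.
  split=> //; first exact: semisimple_of_involutive.
  exact: cosemisimple_of_involutive.
have SS := sovereign_involutive sPhi nz.
split=> //; first exact: semisimple_of_involutive.
exact: cosemisimple_of_involutive.
Qed.
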